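(* Let $q$ be a prime power, let $\mathscr{S}_T$ be a tangent splash of $\ell_\infty$ in $\mathrm{PG}(2,q^3)$ with centre $T$, and let $[\mathscr{S}_T]$ be the corresponding set of spread planes in the Bruck-Bose representation in $\mathrm{PG}(6,q)$. Let $\pi$ be a plane of $\Sigma_\infty\cong\mathrm{PG}(5,q)$ which meets $[T]$ in a line and meets three further elements $[U],[V],[W]$ of $[\mathscr{S}_T]$, where $[T],[U],[V],[W]$ are not contained in a common 2-regulus. Then $\pi$ is a cover plane of $[\mathscr{S}_T]$.
   Context: Bruck-Bose representation: $\Sigma_\infty$ is a hyperplane of $\mathrm{PG}(6,q)$ and $\mathcal{S}$ a regular 2-spread of $\Sigma_\infty$ (partition into $q^3+1$ planes containing the 2-regulus through any three of its planes; a 2-regulus is a set of $q+1$ pairwise disjoint planes such that every line meeting three of them meets all). Affine points of $\mathrm{PG}(2,q^3)$ are points of $\mathrm{PG}(6,q)\setminus\Sigma_\infty$, lines other than $\ell_\infty$ are 3-spaces not in $\Sigma_\infty$ containing a spread plane, and each $X\in\ell_\infty$ corresponds to a spread plane $[X]$; $[\mathscr{S}_T]=\{[X]:X\in\mathscr{S}_T\}$. An order-$q$-subplane is a subplane of order $q$; if it meets $\ell_\infty$ in exactly one point $T$, its tangent splash is the set of $q^2+1$ points of $\ell_\infty$ on extensions of its lines, with centre $T$. A cover plane of $[\mathscr{S}_T]$ is a plane of $\Sigma_\infty$ meeting every plane of $[\mathscr{S}_T]$. *)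

(* Defs.v *)
From HB Require Import structures.
From mathcomp Require Import all_boot all_algebra.

Set Implicit Arguments.
Unset Strict Implicit.
Unset Printing Implicit Defensive.

(* Over a finite field a finite-dimensional space has finitely many subspaces,
   so families of subspaces can be taken in {set {vspace vT}}. *)
Section FiniteSubspaces.

Import VectorInternalTheory.
Variables (F : finFieldType) (vT : vectType F).

HB.instance Definition _ := [Countable of {vspace vT} by <:].
HB.instance Definition _ := [Finite of {vspace vT} by <:].

End FiniteSubspaces.

Section ProjectiveSpace.

Variables (F : finFieldType) (vT : vectType F).
Implicit Types (A B C H P U W : {vspace vT}) (R S X : {set {vspace vT}}).

(* The projective space of vT: a subspace of projective dimension d is a vector
   subspace of dimension d + 1; PG(n, #|F|) is the case vT = 'rV[F]_n.+1. *)
Definition pdim (d : nat) U : bool := \dim U == d.+1.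

Definition ppoint := pdim 0.
Definition pline := pdim 1.
Definition pplane := pdim 2.
Definition psolid := pdim 3.

(* Two subspaces meet when they share a projective point. *)
Definition meets U W : bool := (U :&: W)%VS != 0%VS.

Record regulus2 H R : Prop := Regulus2 {
  regulus2_card : #|R| = #|F|.+1;
  regulus2_plane : forall A, A \in R -> pplane A /\ (A <= H)%VS;
  regulus2_disjoint :
    forall A B, A \in R -> B \in R -> A != B -> ~~ meets A B;
  regulus2_transversal :
    forall l A B C, pline l -> (l <= H)%VS ->
      A \in R -> B \in R -> C \in R -> A != B -> A != C -> B != C ->
      meets l A -> meets l B -> meets l C ->
      forall D, D \in R -> meets l D
}.

Record spread2 H S : Prop := Spread2 {
  spread2_card : #|S| = (#|F| ^ 3).+1;
  spread2_plane : forall A, A \in S -> pplane A /\ (A <= H)%VS;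
  spread2_partition :
    forall P, ppoint P -> (P <= H)%VS -> exists! A, A \in S /\ (P <= A)%VS
}.

(* The 2-regulus through three pairwise disjoint planes of a 5-space is unique,
   so "the 2-regulus through A, B, C is contained in S" is expressed by the
   existence of such a 2-regulus. *)
Definition regular_spread2 H S : Prop :=
  spread2 H S /\
  forall A B C, A \in S -> B \in S -> C \in S ->
    A != B -> A != C -> B != C ->
    exists R, [/\ regulus2 H R, A \in R, B \in R, C \in R & R \subset S].

Definition cover_plane H X U : Prop :=
  [/\ pplane U, (U <= H)%VS & forall A, A \in X -> meets U A].

End ProjectiveSpace.

(* The incidence structure with points Pts, lines Lns and incidence inc is a
   projective plane of order n. *)
Record projective_plane (pT lT : finType) (inc : pT -> lT -> bool) (n : nat)
    (Pts : {set pT}) (Lns : {set lT}) : Prop := ProjectivePlane {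
  pp_join : forall P Q, P \in Pts -> Q \in Pts -> P != Q ->
    exists! l, [/\ l \in Lns, inc P l & inc Q l];
  pp_intersection : forall l m, l \in Lns -> m \in Lns -> l != m ->
    exists! P, [/\ P \in Pts, inc P l & inc P m];
  pp_quadrangle : exists Q : {set pT},
    [/\ Q \subset Pts, #|Q| = 4 &
        forall l, l \in Lns -> #|[set P in Q | inc P l]| <= 2];
  pp_order : forall l, l \in Lns -> #|[set P in Pts | inc P l]| = n.+1
}.

Section TangentSplash.

Variable K : finFieldType.
Local Notation subspace := {vspace 'rV[K]_3}.
Implicit Types (l linf T : subspace) (B M ST : {set subspace}).

Definition subplane (q : nat) B M : Prop :=
  [/\ B \subset [set P | ppoint P], M \subset [set l | pline l] &
      projective_plane (fun P l => (P <= l)%VS) q B M].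

(* B is a set of points and M a set of full lines of PG(2, #|K|), namely the
   extensions of the lines of the subplane. *)
Definition splash linf M : {set subspace} :=
  [set X : subspace | [&& ppoint X, (X <= linf)%VS
                        & [exists l in M, (X <= l)%VS]]].

Definition tangent_splash (q : nat) linf T ST : Prop :=
  exists B M, [/\ subplane q B M,
                  [set P in B | (P <= linf)%VS] = [set T] &
                  ST = splash linf M].

End TangentSplash.

Section BruckBose.

Variables (F K : finFieldType).

(* A representation of PG(2, #|K|) with line at infinity linf: bp sends the
   affine points to the points of PG(6, #|F|) off H and a point X of linf to the
   spread plane [X] = bp X, and bl sends the lines other than linf to the
   3-spaces not in H containing a spread plane. Incidence becomes inclusion. *)
Record bruck_bose (H : {vspace 'rV[F]_7}) (S : {set {vspace 'rV[F]_7}})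
    (linf : {vspace 'rV[K]_3})
    (bp bl : {vspace 'rV[K]_3} -> {vspace 'rV[F]_7}) : Prop := BruckBose {
  bb_hyperplane : pdim 5 H;
  bb_spread : regular_spread2 H S;
  bb_linf : pline linf;
  bb_point_inj : {in [pred P | ppoint P] &, injective bp};
  bb_affine : bp @: [set P | ppoint P & ~~ (P <= linf)%VS]
    = [set P | ppoint P & ~~ (P <= H)%VS];
  bb_infinity : bp @: [set X | ppoint X & (X <= linf)%VS] = S;
  bb_line_inj : {in [pred l | pline l & l != linf] &, injective bl};
  bb_line : bl @: [set l | pline l & l != linf]
    = [set U | [&& psolid U, ~~ (U <= H)%VS
                 & [exists A in S, (A <= U)%VS]]];
  bb_incidence : forall P l, ppoint P -> pline l -> l != linf ->
    (P <= l)%VS = (bp P <= bl l)%VS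
}.

End BruckBose.

(* Main.v *)
Require Import Defs.
From HB Require Import structures.
From mathcomp Require Import all_boot all_algebra.
From mathcomp Require Import finfield ring.

(* An affine point o + v of PG(2, K) corresponds to a point o' + psi v of
   PG(6, F), with psi a bijection from linf onto H. Since parallel lines go to
   parallel solids, psi is additive, and the F-homotheties of H pull back to
   homotheties of linf; so K becomes an extension s : F -> K for which psi is
   F-linear, and psi maps each point X of linf, as a K-line, onto the spread
   plane [X].

   A subplane of order q is F-rational in a suitable frame, so its tangent
   splash lies in {T} and the points <u + d t>, with T = <t> and d in
   D = al F + be F. A plane pi meeting [T] in a line is psi of
   E t + F k (u + e t), with E a 2-dimensional F-space in K, so besides [T] it
   meets [<u + d t>] exactly for d in the affine plane e + E / k. When [T], [U],
   [V], [W] lie in no 2-regulus, the parameters of U, V, W are not F-collinear,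
   and an affine plane containing them contains all of D. *)

Set Implicit Arguments.
Unset Strict Implicit.
Unset Printing Implicit Defensive.

Import GRing.Theory.
Local Open Scope ring_scope.

(** * Points and lines *)

Section Points.
Variables (F : finFieldType) (vT : vectType F).
Implicit Types (u v w : vT) (P Q l U : {vspace vT}).

Lemma ppoint_vline v : v != 0 -> ppoint <[v]>%VS.
Proof. by move=> v0; rewrite /ppoint /pdim dim_vline v0. Qed.

Lemma ppointP P : reflect (exists2 v, v != 0 & P = <[v]>%VS) (ppoint P).
Proof.
apply: (iffP idP) => [|[v v0 ->]]; last exact: ppoint_vline.
move=> /eqP dP; exists (vpick P); first by rewrite vpick0 -dimv_eq0 dP.
apply/esym/eqP; rewrite eqEdim -memvE memv_pick dim_vline vpick0 -dimv_eq0 dP.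
by [].
Qed.

Lemma eq_vline u v : u != 0 -> u \in <[v]>%VS -> <[u]>%VS = <[v]>%VS.
Proof.
move=> u0 uv; apply/eqP; rewrite eqEdim -memvE uv !dim_vline u0.
by case: (v == 0).
Qed.

Lemma scale_vline (k : F) v : k != 0 -> <[k *: v]>%VS = <[v]>%VS.
Proof.
move=> k0; apply/eqP; rewrite eqEsubv -!memvE memvZ ?memv_line //=.
by apply/vlineP; exists k^-1; rewrite scalerA mulVf ?scale1r.
Qed.

Lemma mem_vline2P u v w :
  reflect (exists a b, w = a *: u + b *: v) (w \in <[u]> + <[v]>)%VS.
Proof.
apply: (iffP memv_addP) => [[_ /vlineP[a ->] [_ /vlineP[b ->] ->]]|[a [b ->]]].
  by exists a, b.
by exists (a *: u); rewrite ?memvZ ?memv_line //; exists (b *: v);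
  rewrite ?memvZ ?memv_line.
Qed.

Lemma meetsP U l :
  reflect (exists v, [/\ v != 0, v \in U & v \in l]) (meets U l).
Proof.
apply: (iffP idP) => [m|[v [v0 vU vl]]].
  exists (vpick (U :&: l)); split; first by rewrite vpick0.
    by have := memv_pick (U :&: l); rewrite memv_cap => /andP[].
  by have := memv_pick (U :&: l); rewrite memv_cap => /andP[].
apply: contraNneq v0 => m0.
by rewrite -memv0 -m0 memv_cap vU.
Qed.

Lemma dim_add_vline U v : v \notin U -> \dim (U + <[v]>) = (\dim U).+1.
Proof.
move=> vU; have v0 : v != 0 by apply: contraNneq vU => ->; rewrite mem0v.
rewrite dimv_disjoint_sum ?dim_vline ?v0 ?addn1 //.
apply/eqP; rewrite -subv0; apply/subvP => w; rewrite memv_cap => /andP[wU].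
case/vlineP => k wk; move: wU; rewrite {}wk memv0 scaler_eq0 (negPf v0) orbF.
have [//|k0 kU] := eqVneq k 0; case/negP: vU.
by rewrite -[v](scalerK k0) memvZ.
Qed.

Lemma add_vlineE U l v : v \notin U -> (U <= l)%VS -> v \in l ->
  \dim l = (\dim U).+1 -> (U + <[v]>)%VS = l.
Proof.
move=> vU Ul vl dl; apply/eqP; rewrite eqEdim subv_add Ul -memvE vl /=.
by rewrite dim_add_vline // dl.
Qed.

Lemma pline_join u v l : v != 0 -> u \notin <[v]>%VS -> pline l ->
  u \in l -> v \in l -> l = (<[u]> + <[v]>)%VS.
Proof.
move=> v0 uv /eqP dl ul vl; rewrite addvC; apply/esym/add_vlineE => //.
by rewrite dim_vline v0.
Qed.

End Points.

Lemma exists_notin (F : fieldType) (vT : vectType F) (U L : {vspace vT}) :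
  (\dim U < \dim L)%N -> exists2 v, v \in L & v \notin U.
Proof.
move=> dUL; case: (boolP (L <= U)%VS) => [/dimvS|/subvPn[v vL vU]]; last by exists v.
by rewrite leqNgt dUL.
Qed.

Lemma notin_vlineC (F : finFieldType) (vT : vectType F) (x y : vT) :
  x != 0 -> y \notin <[x]>%VS -> x \notin <[y]>%VS.
Proof. by move=> x0; apply: contra => /(eq_vline x0)->; exact: memv_line. Qed.

(** Since [o] lies outside [H], the coefficient of [o + v] must be 1. Incidence of affine points
    thus becomes a condition on differences of vectors in [H]. *)
Lemma mem_translate (F : fieldType) (vT : vectType F) (H U : {vspace vT})
    (o v w : vT) : (U <= H)%VS -> o \notin H -> v \in H -> w \in H ->
  ((o + w)%R \in (U + <[(o + v)%R]>)%VS) = (w - v \in U).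
Proof.
move=> UH oH vH wH; apply/idP/idP => [|wvU]; last first.
  have -> : o + w = (w - v) + (o + v) by rewrite [o + v]addrC addrA subrK addrC.
  by apply: memv_add; last exact: memv_line.
case/memv_addP=> u uU [_ /vlineP[k ->] e].
have : (1 - k) *: o \in H.
  have -> : (1 - k) *: o = u + k *: v - w.
    rewrite scalerBl scale1r -{1}(addrK w o) e scalerDr.
    by rewrite [k *: o + _]addrC addrA [LHS]addrAC addrK.
  by rewrite rpredB ?rpredD ?rpredZ // (subvP UH).
have [k1 _|k1 kH] := eqVneq (1 - k) 0; last first.
  by case/negP: oH; rewrite -[o](scalerK k1) rpredZ.
move: e; rewrite -(subr0_eq k1) scale1r addrCA => /addrI ->.
by rewrite addrK.
Qed.

(** * Semilinearity of a bijection that preserves parallel classes *)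

Section Linearise.

Variables (F K : finFieldType) (n : nat) (wT : vectType F).
Variables (L : {vspace 'rV[K]_n}) (H : {vspace wT}).
Variables (sp : {vspace 'rV[K]_n} -> {vspace wT}) (psi : 'rV[K]_n -> wT).
Hypotheses (dL : \dim L = 2) (psi0 : psi 0 = 0).
Hypothesis psiH : forall v, v \in L -> psi v \in H.
Hypothesis psi_surj : forall w, w \in H -> exists2 v, v \in L & psi v = w.
Hypothesis psi_sub : forall x v w, x \in L -> x != 0 -> v \in L -> w \in L ->
  (psi w - psi v \in sp <[x]>%VS) = (w - v \in <[x]>%VS).

Lemma chart_mem x v : x \in L -> x != 0 -> v \in L ->
  (psi v \in sp <[x]>%VS) = (v \in <[x]>%VS).
Proof. by move=> xL x0 vL; have := psi_sub xL x0 (mem0v L) vL; rewrite psi0 !subr0. Qed.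

Lemma exists_off x : exists2 y, y \in L & y \notin <[x]>%VS.
Proof. by apply: exists_notin; rewrite dL dim_vline; case: (x != 0). Qed.

Lemma spread_disjoint x y w : x \in L -> x != 0 -> y \in L -> y \notin <[x]>%VS ->
  w \in H -> w \in sp <[x]>%VS -> w \in sp <[y]>%VS -> w = 0.
Proof.
move=> xL x0 yL yx /psi_surj[v vL <-].
have y0 : y != 0 by apply: contraNneq yx => ->; rewrite mem0v.
rewrite !chart_mem // => vx /vlineP[k vE]; move: vx; rewrite {}vE.
have [->|k0 kx] := eqVneq k 0; first by rewrite scale0r psi0.
by case/negP: yx; rewrite -[y](scalerK k0) rpredZ.
Qed.

(* Parallelogram rule: x + y is where the parallels through x and y meet. *)
Lemma chartD_off x y : x \in L -> y \in L -> y \notin <[x]>%VS ->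
  psi (x + y) = psi x + psi y.
Proof.
move=> xL yL yx.
have [->|x0] := eqVneq x 0; first by rewrite psi0 !add0r.
have y0 : y != 0 by apply: contraNneq yx => ->; rewrite mem0v.
have xyL : x + y \in L by rewrite rpredD.
apply/eqP; rewrite -subr_eq0; apply/eqP.
apply: (@spread_disjoint x y) => //; first by rewrite rpredB ?rpredD // psiH.
  rewrite opprD addrCA addrC rpredB //; last by rewrite chart_mem ?memv_line.
  by rewrite psi_sub // addrK memv_line.
rewrite opprD addrA rpredB //; last by rewrite chart_mem ?memv_line.
by rewrite psi_sub // [x + y]addrC addrK memv_line.
Qed.

(** For dependent [x] and [y], take [z] off [<[x]>] and expand [(x + y) + z = x + (y + z)] both
    ways; every sum expanded is then covered by [chartD_off]. *)
Lemma chartD x y : x \in L -> y \in L -> psi (x + y) = psi x + psi y.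
Proof.
move=> xL yL; have [yx|] := boolP (y \in <[x]>%VS); last exact: chartD_off.
have [z zL zx] := exists_off x.
have sub u : u \in <[x]>%VS -> z \notin <[u]>%VS.
  by move=> ux; apply: contra zx; apply/subvP; rewrite -memvE.
have yzx : y + z \notin <[x]>%VS.
  by apply: contra zx => yzx; rewrite -(addKr y z) rpredD ?rpredN.
apply: (addIr (psi z)); have xyx : x + y \in <[x]>%VS by rewrite rpredD ?memv_line.
rewrite -(@chartD_off (x + y)) ?(sub _ xyx) //; last exact: rpredD.
by rewrite -addrA (chartD_off xL (rpredD yL zL) yzx) (chartD_off yL zL (sub y yx)) addrA.
Qed.

Lemma chart_eq0 v : v \in L -> psi v = 0 -> v = 0.
Proof.
move=> vL pv; apply/eqP; have [//|v0] := eqVneq v 0.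
have [y yL yv] := exists_off v.
have y0 : y != 0 by apply: contraNneq yv => ->; rewrite mem0v.
by have := notin_vlineC v0 yv; rewrite -chart_mem // pv mem0v.
Qed.

Lemma chart_inj v w : v \in L -> w \in L -> psi v = psi w -> v = w.
Proof.
move=> vL wL e; apply/eqP; rewrite -subr_eq0; apply/eqP.
apply: chart_eq0; first by rewrite rpredB.
by apply: (addIr (psi w)); rewrite -chartD ?rpredB // subrK add0r.
Qed.

(* An additive map fixing every one-dimensional subspace of L is a scalar. *)
Lemma chart_scalar (c : F) :
  exists k : K, forall v, v \in L -> psi (k *: v) = c *: psi v.
Proof.
(* [g] is the homothety of [H] with factor [c], pulled back along [psi]. *)
have [g gP] : exists g : 'rV[K]_n -> 'rV[K]_n,
    forall v, v \in L -> g v \in L /\ psi (g v) = c *: psi v.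
  apply: (@fin_all_exists _ (fun=> 'rV[K]_n) (fun v u =>
    v \in L -> u \in L /\ psi u = c *: psi v)) => v.
  have [vL|//] := boolP (v \in L); last by exists 0.
  by have [|u uL e] := @psi_surj (c *: psi v); [rewrite rpredZ ?psiH | exists u].
have gD u v : u \in L -> v \in L -> g (u + v) = g u + g v.
  move=> uL vL; have [[gu e1] [gv e2]] := (gP u uL, gP v vL).
  have [guv e3] := gP _ (rpredD uL vL).
  by apply: chart_inj; rewrite ?rpredD // e3 !chartD // scalerDr e1 e2.
have gline v : v \in L -> exists k, g v = k *: v.
  move=> vL; have [gv e] := gP v vL.
  have [v0|v0] := eqVneq v 0; last first.
    by apply/vlineP; rewrite -chart_mem // e rpredZ // chart_mem ?memv_line.
  exists 0; rewrite v0 scaler0; apply: chart_eq0; rewrite -v0 // e v0 psi0.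
  exact: scaler0.
(* Comparing [g (u + v) = k *: (u + v)] with [a *: u + b *: v] gives [a = k = b]. *)
have gsame u v a b : u \in L -> u != 0 -> v \in L -> v \notin <[u]>%VS ->
    g u = a *: u -> g v = b *: v -> a = b.
  move=> uL u0 vL vu gu gv; have [k] := gline _ (rpredD uL vL).
  rewrite gD // gu gv scalerDr => e.
  have e' : (a - k) *: u = (k - b) *: v.
    rewrite !scalerBl; apply/eqP; rewrite subr_eq addrAC eq_sym.
    by rewrite subr_eq e addrC.
  have kb : k - b = 0.
    apply/eqP; apply: contraNT vu => kb0.
    by rewrite -[v](scalerK kb0) -e' !rpredZ ?memv_line.
  move: e'; rewrite kb scale0r => /eqP; rewrite scaler_eq0 (negPf u0) orbF.
  by rewrite subr_eq0 => /eqP->; apply/subr0_eq.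
have [x xL x0] : exists2 x, x \in L & x != 0.
  have [|x xL] := @exists_notin _ _ (0%VS : {vspace 'rV[K]_n}) L.
    by rewrite dimv0 dL.
  by rewrite memv0; exists x.
have [y yL yx] := exists_off x.
have [[a ga] [b gb]] := (gline x xL, gline y yL).
have ab := gsame x y a b xL x0 yL yx ga gb.
exists a => v vL; have [gv <-] := gP v vL; congr psi.
have [k gk] := gline v vL; rewrite gk.
have [->|v0] := eqVneq v 0; first by rewrite !scaler0.
(* A multiple of [x] is not independent of [x], so it is compared with [y] instead. *)
have [vx|vx] := boolP (v \in <[x]>%VS); last by rewrite (gsame x v a k).
rewrite ab (gsame v y k b) //; apply: contra yx.
by apply/subvP; rewrite -memvE.
Qed.

(** Injectivity of [psi] makes the scalar attached to [c] unique, so sums and products in [F] can be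
    compared on one nonzero vector [x]. *)
Lemma chart_semilinear :
  exists s : {rmorphism F -> K}, forall c v, v \in L -> psi (s c *: v) = c *: psi v.
Proof.
have [s sP] := fin_all_exists chart_scalar.
have [x xL x0] : exists2 x, x \in L & x != 0.
  have [|x xL] := @exists_notin _ _ (0%VS : {vspace 'rV[K]_n}) L.
    by rewrite dimv0 dL.
  by rewrite memv0; exists x.
have sI a b : psi (a *: x) = psi (b *: x) -> a = b.
  move/chart_inj => /(_ (rpredZ _ xL) (rpredZ _ xL)) /eqP.
  by rewrite -subr_eq0 -scalerBl scaler_eq0 (negPf x0) orbF subr_eq0 => /eqP.
have sD a b : s (a + b) = s a + s b.
  by apply: sI; rewrite sP // !scalerDl chartD ?rpredZ // !sP.
have s0 : s 0 = 0 by apply: (addIr (s 0)); rewrite -sD !add0r.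
have sB : zmod_morphism s.
  by move=> a b; apply: (addIr (s b)); rewrite -sD !subrK.
have s1 : monoid_morphism s.
  split; first by apply: sI; rewrite sP // !scale1r.
  by move=> a b; apply: sI; rewrite sP // -!scalerA !sP // rpredZ.
pose sM : {rmorphism F -> K} := HB.pack s
  (GRing.isZmodMorphism.Build F K s sB) (GRing.isMonoidMorphism.Build F K s s1).
by exists sM.
Qed.

End Linearise.

(** * The Bruck-Bose map is semilinear *)

Section BruckBoseLinear.

Variables (F K : finFieldType).
Variables (H : {vspace 'rV[F]_7}) (S : {set {vspace 'rV[F]_7}}).
Variables (linf : {vspace 'rV[K]_3}).
Variables (bp bl : {vspace 'rV[K]_3} -> {vspace 'rV[F]_7}).
Hypothesis hBB : bruck_bose H S linf bp bl.

Lemma bp_infinity X : ppoint X -> (X <= linf)%VS -> pplane (bp X) /\ (bp X <= H)%VS.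
Proof.
move=> pX Xl; have [sp _] := bb_spread hBB; apply: (spread2_plane sp).
by rewrite -(bb_infinity hBB); apply: imset_f; rewrite inE pX.
Qed.

Lemma affine_point (E : finFieldType) n (U : {vspace 'rV[E]_n}) o v :
  o \notin U -> v \in U ->
  [/\ o + v != 0, ppoint <[o + v]>%VS & ~~ (<[o + v]> <= U)%VS].
Proof.
move=> oU vU; have ovU : o + v \notin U.
  by apply: contra oU => ovU; rewrite -(addrK v o) rpredB.
have ov0 : o + v != 0 by apply: contraNneq ovU => ->; rewrite mem0v.
by split; rewrite ?ppoint_vline // -memvE.
Qed.

Lemma affine_pointE (o : 'rV[F]_7) P : o \notin H -> ppoint P -> ~~ (P <= H)%VS ->
  exists2 w, w \in H & P = <[o + w]>%VS.
Proof.
move=> oH /ppointP[p p0 ->]; rewrite -memvE => pH.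
have : o \in (H + <[p]>)%VS.
  rewrite (@add_vlineE _ _ _ fullv) ?memvf ?subvf //.
  by rewrite dimvf (eqP (bb_hyperplane hBB)).
case/memv_addP => h hH [_ /vlineP[k ->] e].
have k0 : k != 0 by apply: contraNneq oH => k0; rewrite e k0 scale0r addr0.
exists (- h); first by rewrite rpredN.
by rewrite e addrAC subrr add0r scale_vline.
Qed.

(** [psi] is [bp] in affine coordinates with origins [o] and [o']. The last clause holds because the
    line joining [<[x]>] to [<[o + v]>] goes to the solid joining [bp <[x]>] to [<[o' + psi v]>]. *)
Lemma bruck_bose_coordinate : exists psi : 'rV[K]_3 -> 'rV[F]_7,
  [/\ psi 0 = 0, forall v, v \in linf -> psi v \in H,
      forall w, w \in H -> exists2 v, v \in linf & psi v = w &
      forall x v w, x \in linf -> x != 0 -> v \in linf -> w \in linf ->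
        (psi w - psi v \in bp <[x]>%VS) = (w - v \in <[x]>%VS)].
Proof.
have dl : \dim linf = 2 by exact/eqP/(bb_linf hBB).
have dH : \dim H = 6 by exact/eqP/(bb_hyperplane hBB).
have [o _ ol] : exists2 o, o \in fullv & o \notin linf.
  by apply: exists_notin; rewrite dl dimvf.
have bpA v : v \in linf -> ppoint (bp <[o + v]>%VS) /\ ~~ (bp <[o + v]> <= H)%VS.
  move=> vl; have [ov0 pv nv] := affine_point ol vl.
  have : bp <[o + v]>%VS \in bp @: [set P | ppoint P & ~~ (P <= linf)%VS].
    by apply: imset_f; rewrite inE pv.
  by rewrite (bb_affine hBB) inE => /andP[].
(* The new origin represents the image of the old one, which gives [psi 0 = 0]. *)
have [o' o'0 o'E] : exists2 o', o' != 0 & bp <[o + 0]>%VS = <[o']>%VS.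
  by apply/ppointP; case: (bpA 0 (mem0v _)).
have o'H : o' \notin H by rewrite memvE -o'E; case: (bpA 0 (mem0v _)).
have [psi psiP] : exists psi : 'rV[K]_3 -> 'rV[F]_7,
    forall v, v \in linf -> psi v \in H /\ bp <[o + v]>%VS = <[o' + psi v]>%VS.
  apply: (@fin_all_exists _ (fun=> 'rV[F]_7) (fun v u =>
    v \in linf -> u \in H /\ bp <[o + v]>%VS = <[o' + u]>%VS)) => v.
  have [vl|//] := boolP (v \in linf); last by exists 0.
  have [pv nv] := bpA v vl.
  by have [w wH e] := affine_pointE o'H pv nv; exists w.
have oI w w' : w \in H -> w' \in H -> <[o' + w]>%VS = <[o' + w']>%VS -> w = w'.
  move=> wH w'H e; apply/eqP; rewrite -subr_eq0 -memv0.
  by rewrite -(mem_translate (sub0v H) o'H) // add0v -e memv_line.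
exists psi; split.
- have [p0H p0E] := psiP 0 (mem0v _); apply: oI; rewrite ?mem0v //.
  by rewrite -p0E o'E addr0.
- by move=> v /psiP[].
- move=> w wH; have [ow0 pw nw] := affine_point o'H wH.
  have : <[o' + w]>%VS \in [set P | ppoint P & ~~ (P <= H)%VS] by rewrite inE pw.
  rewrite -(bb_affine hBB) => /imsetP[P]; rewrite inE => /andP[/ppointP[p p0 ->]].
  rewrite -memvE => pl e.
  have : o \in (linf + <[p]>)%VS.
    by rewrite (@add_vlineE _ _ _ fullv) ?memvf ?subvf // dimvf dl.
  case/memv_addP => v vl [_ /vlineP[k ->] oE].
  have k0 : k != 0 by apply: contraNneq ol => k0; rewrite oE k0 scale0r addr0.
  have nvl : - v \in linf by rewrite rpredN.
  have [pv e'] := psiP (- v) nvl; exists (- v) => //; apply: oI => //.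
  by rewrite e -e' oE addrAC subrr add0r scale_vline.
move=> x v w xl x0 vl wl.
have xlinf : (<[x]> <= linf)%VS by rewrite -memvE.
have [px [/eqP dx xH]] := (ppoint_vline x0, bp_infinity (ppoint_vline x0) xlinf).
have [[pv pvE] [pw pwE]] := (psiP v vl, psiP w wl).
have [[ov0 qv nv] [ow0 qw nw]] := (affine_point ol vl, affine_point ol wl).
rewrite -(mem_translate xH o'H pv pw) -(mem_translate xlinf ol vl wl).
set l := (<[x]> + <[o + v]>)%VS.
have ovx : o + v \notin <[x]>%VS.
  by apply: contra nv => /(subvP xlinf); rewrite memvE.
have ll : pline l by rewrite /pline /pdim dim_add_vline // dim_vline x0.
have nl : l != linf.
  apply: contraNneq nv => <-; exact: addvSr.
have : bl l \in bl @: [set l | pline l & l != linf].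
  by apply: imset_f; rewrite inE ll.
rewrite (bb_line hBB) inE => /and3P[/eqP dbl _ _].
have inc P : ppoint P -> (P <= l)%VS = (bp P <= bl l)%VS.
  by move=> pP; apply: (bb_incidence hBB).
(* Both sides have dimension 4: the solid [bl l] contains the plane [bp <[x]>] and a point off
   [H]. *)
have -> : (bp <[x]> + <[o' + psi v]>)%VS = bl l.
  apply: add_vlineE.
  - by apply: contra (proj2 (bpA v vl)) => /(subvP xH); rewrite pvE memvE.
  - by rewrite -inc // addvSl.
  - by rewrite memvE -pvE -inc // addvSr.
  - by rewrite dbl dx.
by rewrite memvE -pwE -inc // memvE.
Qed.

Lemma bruck_bose_linear :
  exists (s : {rmorphism F -> K}) (psi : 'rV[K]_3 -> 'rV[F]_7),
  [/\ forall v, v \in linf -> psi v \in H,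
      forall w, w \in H -> exists2 v, v \in linf & psi v = w,
      {in linf &, injective psi} /\ {in linf &, {morph psi : v w / v + w}},
      forall c v, v \in linf -> psi (s c *: v) = c *: psi v &
      forall x v, x \in linf -> x != 0 -> v \in linf ->
        (psi v \in bp <[x]>%VS) = (v \in <[x]>%VS)].
Proof.
have [psi [psi0 psiH psiS psiB]] := bruck_bose_coordinate.
have dl : \dim linf = 2 by exact/eqP/(bb_linf hBB).
have [s sP] := chart_semilinear dl psi0 psiH psiS psiB.
exists s, psi; split=> // [|x v xl x0 vl].
  split=> v w vl wl; first exact: (chart_inj dl psi0 psiH psiS psiB).
  exact: (chartD dl psi0 psiH psiS psiB).
exact: (chart_mem psi0 psiB).
Qed.

End BruckBoseLinear.

(** * Coordinates of a subplane *)

(** Multiplication by [x] permutes [A], so the nonzero product of all elements of [A] is unchanged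
    when multiplied by [x ^+ #|A|]. *)
Lemma expr_card_closed (K : finFieldType) (A : {set K}) (x : K) :
  0 \notin A -> (forall y, y \in A -> x * y \in A) -> x != 0 -> x ^+ #|A| = 1.
Proof.
move=> A0 Ax x0.
have xI : injective ( *%R x) by exact: mulfI.
have xA : [set x * y | y in A] = A.
  apply/eqP; rewrite eqEcard card_imset // leqnn andbT.
  by apply/subsetP => _ /imsetP[y yA ->]; exact: Ax.
have p0 : \prod_(y in A) y != 0.
  by apply/prodf_neq0 => y yA; apply: contraNneq A0 => <-.
apply: (mulIf p0); rewrite mul1r -prodr_const -big_split /=.
by rewrite -[in RHS]xA big_imset //= => ? ? _ _ /xI.
Qed.

(** Over [F] the polynomial ['X^#|F| - 'X] is the product of all ['X - c%:P]. Its image under [s]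
    vanishes at [x], so some factor does. *)
Lemma expr_card_im (F K : finFieldType) (s : {rmorphism F -> K}) (x : K) :
  x ^+ #|F| = x -> exists c, x = s c.
Proof.
move=> xq; have := congr1 (fun p => (map_poly s p).[x]) (finField_genPoly F).
rewrite rmorphB /= map_polyXn map_polyX hornerD hornerN hornerXn hornerX xq subrr.
move/esym/eqP; rewrite rmorph_prod horner_prod prodf_seq_eq0 => /hasP[c _ /=].
by rewrite rmorphB /= map_polyX map_polyC /= hornerXsubC subr_eq0 => /eqP; exists c.
Qed.

Section Coordinates.

Variables (K : fieldType) (vT : vectType K) (p0 p1 p2 : vT).

Definition comb3 (a b c : K) : vT := a *: p0 + b *: p1 + c *: p2.

Lemma comb3D a b c a' b' c' :
  comb3 a b c + comb3 a' b' c' = comb3 (a + a') (b + b') (c + c').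
Proof. by rewrite /comb3 !scalerDl addrACA [X in X + _]addrACA. Qed.

Lemma comb3Z k a b c : k *: comb3 a b c = comb3 (k * a) (k * b) (k * c).
Proof. by rewrite /comb3 !scalerDr !scalerA. Qed.

Lemma comb3_100 : comb3 1 0 0 = p0.
Proof. by rewrite /comb3 !scale0r !addr0 scale1r. Qed.

Lemma comb3_010 : comb3 0 1 0 = p1.
Proof. by rewrite /comb3 !scale0r addr0 add0r scale1r. Qed.

Lemma comb3_001 : comb3 0 0 1 = p2.
Proof. by rewrite /comb3 !scale0r !add0r scale1r. Qed.

Hypothesis p_free : forall a b c, comb3 a b c = 0 -> [/\ a = 0, b = 0 & c = 0].

Lemma comb3_inj a b c a' b' c' : comb3 a b c = comb3 a' b' c' ->
  [/\ a = a', b = b' & c = c'].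
Proof.
move=> e; have : comb3 (a - a') (b - b') (c - c') = 0.
  have <- : comb3 a b c - comb3 a' b' c' = comb3 (a - a') (b - b') (c - c').
    by rewrite -scaleN1r comb3Z comb3D !mulN1r.
  by rewrite e subrr.
by case/p_free => /subr0_eq-> /subr0_eq-> /subr0_eq->.
Qed.

End Coordinates.

Section Subplane.

Variables (K : finFieldType) (q : nat) (B M : {set {vspace 'rV[K]_3}}).
Hypothesis hB : subplane q B M.

Lemma subplane_point P : P \in B -> ppoint P.
Proof. by case: hB => /subsetP BP _ _ /BP; rewrite inE. Qed.

Lemma subplane_point_neq0 (v : 'rV[K]_3) : <[v]>%VS \in B -> v != 0.
Proof. by move/subplane_point; rewrite /ppoint /pdim dim_vline; case: (v != 0). Qed.

Lemma subplane_line l : l \in M -> pline l.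
Proof. by case: hB => _ /subsetP ML _ /ML; rewrite inE. Qed.

Lemma subplane_join (u v : 'rV[K]_3) : <[u]>%VS \in B -> <[v]>%VS \in B ->
  u \notin <[v]>%VS -> (<[u]> + <[v]>)%VS \in M.
Proof.
case: hB => _ _ pp uB vB uv.
have uv' : <[u]>%VS != <[v]>%VS by apply: contraNneq uv => <-; exact: memv_line.
have [l [[lM ul vl] _]] := pp_join pp uB vB uv'.
rewrite -!memvE in ul vl.
by rewrite -(pline_join (subplane_point_neq0 vB) uv (subplane_line lM) ul vl).
Qed.

(** If [z] were not the point of [B] where the two lines meet, both lines would be spanned by these
    two points and coincide. Ruler constructions therefore stay in [B]. *)
Lemma subplane_meet (u v u' v' z : 'rV[K]_3) :
  <[u]>%VS \in B -> <[v]>%VS \in B -> <[u']>%VS \in B -> <[v']>%VS \in B ->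
  u \notin <[v]>%VS -> u' \notin <[v']>%VS -> u' \notin (<[u]> + <[v]>)%VS ->
  z != 0 -> z \in (<[u]> + <[v]>)%VS -> z \in (<[u']> + <[v']>)%VS ->
  <[z]>%VS \in B.
Proof.
move=> uB vB u'B v'B uv u'v' u'l z0 zl zm.
have lM := subplane_join uB vB uv; have mM := subplane_join u'B v'B u'v'.
have lm : (<[u]> + <[v]>)%VS != (<[u']> + <[v']>)%VS.
  by apply: contraNneq u'l => ->; rewrite memvE addvSl.
case: hB => _ _ pp; have [P [[PB Pl Pm] _]] := pp_intersection pp lM mM lm.
have /ppointP[p p_neq0 PE] := subplane_point PB.
rewrite PE -!memvE in PB Pl Pm.
have [zp|zp] := boolP (z \in <[p]>%VS); first by rewrite (eq_vline z0 zp).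
case/eqP: lm; rewrite (pline_join p_neq0 zp (subplane_line lM) zl Pl).
by rewrite (pline_join p_neq0 zp (subplane_line mM) zm Pm).
Qed.

(** Three points of a quadrangle give a basis. No coordinate of the fourth vanishes, since otherwise
    it would be collinear with two of the others, so rescaling the basis makes it the unit point. *)
Lemma subplane_frame : exists p0 p1 p2 : 'rV[K]_3,
  [/\ forall a b c, comb3 p0 p1 p2 a b c = 0 -> [/\ a = 0, b = 0 & c = 0],
      forall v, exists a b c, v = comb3 p0 p1 p2 a b c &
      [/\ <[p0]>%VS \in B, <[p1]>%VS \in B, <[p2]>%VS \in B
         & <[comb3 p0 p1 p2 1 1 1]>%VS \in B]].
Proof.
case: hB => _ _ pp; have [Q [QB Q4 Q2]] := pp_quadrangle pp.
have Qcol X Y Z : X \in Q -> Y \in Q -> Z \in Q -> uniq [:: X; Y; Z] ->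
    ~~ (Z <= X + Y)%VS.
  move=> XQ YQ ZQ; rewrite /= !inE negb_or andbT => /andP[/andP[XY XZ] YZ].
  have [l [[lM Xl Yl] _]] := pp_join pp (subsetP QB _ XQ) (subsetP QB _ YQ) XY.
  have := Q2 l lM; apply: contraL => ZXY; rewrite -ltnNge.
  apply: (@leq_trans #|[set X; Y; Z]|).
    by rewrite setUC cardsU1 cards2 XY !inE negb_or ![Z == _]eq_sym XZ YZ.
  apply/subset_leq_card/subsetP => P; rewrite !inE.
  case/orP=> [/orP[]|] /eqP->; rewrite ?XQ ?YQ ?ZQ //=.
  by rewrite (subv_trans ZXY) // subv_add Xl.
have := enum_uniq Q; have := mem_enum Q; move: Q4; rewrite cardE.
case: (enum Q) => [|X0 [|X1 [|X2 [|X3 []]]]] //= _ inQ.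
rewrite !inE !negb_or !andbT => /and3P[/and3P[n01 n02 n03] /andP[n12 n13] n23].
have [iX0 iX1 iX2 iX3] : [/\ X0 \in Q, X1 \in Q, X2 \in Q & X3 \in Q].
  by rewrite -!inQ !inE !eqxx !orbT.
have c012 : ~~ (X2 <= X0 + X1)%VS by apply: Qcol; rewrite //= !inE negb_or n01 n02 n12.
have c013 : ~~ (X3 <= X0 + X1)%VS by apply: Qcol; rewrite //= !inE negb_or n01 n03 n13.
have c023 : ~~ (X3 <= X0 + X2)%VS by apply: Qcol; rewrite //= !inE negb_or n02 n03 n23.
have c123 : ~~ (X3 <= X1 + X2)%VS by apply: Qcol; rewrite //= !inE negb_or n12 n13 n23.
have BQ X : X \in Q -> X \in B by exact: (subsetP QB).
have /ppointP[e0 e00 E0] := subplane_point (BQ _ iX0).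
have /ppointP[e1 e10 E1] := subplane_point (BQ _ iX1).
have /ppointP[e2 e20 E2] := subplane_point (BQ _ iX2).
have /ppointP[e3 e30 E3] := subplane_point (BQ _ iX3).
move: (BQ _ iX0) (BQ _ iX1) (BQ _ iX2) (BQ _ iX3) => {BQ}.
rewrite {}E0 {}E1 {}E2 {}E3 -?memvE in n01 c012 c013 c023 c123 *.
move=> B0 B1 B2 B3.
have e10n : e1 \notin <[e0]>%VS.
  by apply: contraNN n01 => /(eq_vline e10)->.
have full : (<[e0]> + <[e1]> + <[e2]>)%VS = fullv.
  apply: add_vlineE; rewrite ?memvf ?subvf // dimvf.
  by rewrite dim_add_vline // dim_vline e00.
have span v : exists a b c, v = comb3 e0 e1 e2 a b c.
  have : v \in (<[e0]> + <[e1]> + <[e2]>)%VS by rewrite full memvf.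
  case/memv_addP => _ /mem_vline2P[a [b ->]] [_ /vlineP[c ->] ->].
  by exists a, b, c.
have [a [b [c e3E]]] := span e3.
have a0 : a != 0.
  apply: contraNneq c123 => a0; apply/mem_vline2P; exists b, c.
  by rewrite e3E a0 /comb3 scale0r add0r.
have b0 : b != 0.
  apply: contraNneq c023 => b0; apply/mem_vline2P; exists a, c.
  by rewrite e3E b0 /comb3 scale0r addr0.
have c0 : c != 0.
  apply: contraNneq c013 => c0; apply/mem_vline2P; exists a, b.
  by rewrite e3E c0 /comb3 scale0r addr0.
have scaled x y z : comb3 (a *: e0) (b *: e1) (c *: e2) x y z =
    comb3 e0 e1 e2 (x * a) (y * b) (z * c) by rewrite /comb3 !scalerA.
exists (a *: e0), (b *: e1), (c *: e2); split; last first.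
- by rewrite !scale_vline // scaled !mul1r -e3E.
- move=> v; have [x [y [z vE]]] := span v.
  by exists (x / a), (y / b), (z / c); rewrite scaled !divfK.
have free x y z : comb3 e0 e1 e2 x y z = 0 -> [/\ x = 0, y = 0 & z = 0].
  have [->|z0] := eqVneq z 0; last first.
    move=> e; case/negP: c012; rewrite -[e2](scalerK z0) rpredZ //.
    apply/mem_vline2P; exists (- x), (- y); rewrite !scaleNr -opprD.
    by apply/eqP; rewrite -addr_eq0 addrC -[X in _ == X]e.
  have [->|y0] := eqVneq y 0; last first.
    move=> e; case/negP: e10n; rewrite -[e1](scalerK y0) rpredZ //.
    apply/vlineP; exists (- x); rewrite scaleNr.
    by apply/eqP; rewrite -addr_eq0 addrC -[X in _ == X]e /comb3 scale0r addr0.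
  rewrite /comb3 !scale0r !addr0 => /eqP.
  by rewrite scaler_eq0 (negPf e00) orbF => /eqP->.
move=> x y z; rewrite scaled => /free[/eqP xa /eqP yb /eqP zc].
move: xa yb zc; rewrite !mulf_eq0 (negPf a0) (negPf b0) (negPf c0) !orbF.
by move=> /eqP-> /eqP-> /eqP->.
Qed.

Section Frame.

Variables p0 p1 p2 : 'rV[K]_3.
Local Notation vec := (comb3 p0 p1 p2).
Hypothesis p_free : forall a b c, vec a b c = 0 -> [/\ a = 0, b = 0 & c = 0].
Hypothesis p_span : forall v, exists a b c, v = vec a b c.
Hypotheses (p0B : <[vec 1 0 0]>%VS \in B) (p1B : <[vec 0 1 0]>%VS \in B).
Hypotheses (p2B : <[vec 0 0 1]>%VS \in B) (p3B : <[vec 1 1 1]>%VS \in B).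

(** The expression is the determinant with rows [u], [v], [w]; it vanishes identically once a linear
    dependency is substituted. *)
Lemma notin_det u0 u1 u2 v0 v1 v2 w0 w1 w2 :
  u0 * (v1 * w2 - v2 * w1) - u1 * (v0 * w2 - v2 * w0)
    + u2 * (v0 * w1 - v1 * w0) != 0 ->
  vec w0 w1 w2 \notin (<[vec u0 u1 u2]> + <[vec v0 v1 v2]>)%VS
  /\ vec u0 u1 u2 \notin <[vec v0 v1 v2]>%VS.
Proof.
move=> d0; split; apply: contraNN d0.
  case/mem_vline2P => a [b]; rewrite !comb3Z comb3D.
  by case/(comb3_inj p_free) => -> -> ->; apply/eqP; ring.
case/vlineP => a; rewrite comb3Z.
by case/(comb3_inj p_free) => -> -> ->; apply/eqP; ring.
Qed.

(* The affine point (1, x, y) projected from the point (0, b, c) at infinity. *)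
Lemma project x y b c u0 u1 u2 v0 v1 v2 x' y' k i j :
  <[vec 1 x y]>%VS \in B -> <[vec 0 b c]>%VS \in B ->
  <[vec u0 u1 u2]>%VS \in B -> <[vec v0 v1 v2]>%VS \in B ->
  u0 * (v1 * c - v2 * b) - u1 * (v0 * c) + u2 * (v0 * b) != 0 ->
  vec 1 x' y' = vec 1 x y + k *: vec 0 b c ->
  vec 1 x' y' = i *: vec u0 u1 u2 + j *: vec v0 v1 v2 ->
  <[vec 1 x' y']>%VS \in B.
Proof.
move=> tB wB uB vB d e1 e2.
have [|wuv uv] := @notin_det u0 u1 u2 v0 v1 v2 0 b c.
  by rewrite !mulr0 !subr0.
apply: (subplane_meet uB vB wB tB) => //.
- apply/vlineP => -[a]; rewrite comb3Z => /(comb3_inj p_free)[+ bE cE].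
  rewrite mulr1 => a0; case/negP: (subplane_point_neq0 wB).
  by rewrite bE cE -a0 !mul0r /comb3 !scale0r !addr0.
- by apply/eqP => /p_free[/eqP]; rewrite oner_eq0.
- by rewrite e2; apply/mem_vline2P; exists i, j.
rewrite e1 addrC -[X in _ + X]scale1r; by apply/mem_vline2P; exists k, 1.
Qed.

Ltac vec_ring := by rewrite !comb3Z comb3D; congr comb3; ring.
Ltac det_unit e := by rewrite (_ : _ - _ + _ = e) ?oppr_eq0 ?oner_eq0 //; ring.

(** * Ruler constructions in affine coordinates [(x, y)] *)

Lemma project_x x y : <[vec 1 x y]>%VS \in B -> <[vec 1 x 0]>%VS \in B.
Proof.
move=> tB; apply: (project (k := - y) (i := 1) (j := x) tB p2B p0B p1B).
- det_unit (1 : K).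
- vec_ring.
- vec_ring.
Qed.

Lemma project_y x y : <[vec 1 x y]>%VS \in B -> <[vec 1 0 y]>%VS \in B.
Proof.
move=> tB; apply: (project (k := - x) (i := 1) (j := y) tB p1B p0B p2B).
- det_unit (- 1 : K).
- vec_ring.
- vec_ring.
Qed.

(** The horizontal through [(0, y)] meets the diagonal at [(y, y)], which drops to [(y, 0)]. *)
Lemma project_diag y : <[vec 1 0 y]>%VS \in B -> <[vec 1 y 0]>%VS \in B.
Proof.
move=> tB; apply: (@project_x y y).
apply: (project (k := y) (i := 1 - y) (j := y) tB p1B p0B p3B).
- det_unit (- 1 : K).
- vec_ring.
- vec_ring.
Qed.

(** The vertical through [(x, 0)] meets the line joining the origin to [(1, y)] at height
    [x * y]. *)
Lemma project_slope x y : <[vec 1 x 0]>%VS \in B -> <[vec 1 1 y]>%VS \in B ->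
  <[vec 1 x (x * y)]>%VS \in B.
Proof.
move=> tB yB; apply: (project (k := x * y) (i := 1 - x) (j := x) tB p2B p0B yB).
- det_unit (1 : K).
- vec_ring.
- vec_ring.
Qed.

Lemma project_diagV y : <[vec 1 y 0]>%VS \in B -> <[vec 1 0 y]>%VS \in B.
Proof.
move=> tB; apply: (@project_y y); rewrite -[X in vec _ _ X]mulr1.
exact: project_slope.
Qed.

Lemma project_one y : <[vec 1 0 y]>%VS \in B -> <[vec 1 1 y]>%VS \in B.
Proof.
move=> yB; have oneB := project_x p3B.
apply: (project (k := y) (i := 1) (j := 1) oneB p2B p1B yB).
- det_unit (- 1 : K).
- vec_ring.
- vec_ring.
Qed.

(** The line through the origin with slope [y] passes through [(1, y)], whose height is then carried
    to the first axis. *)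
Lemma project_infty y : <[vec 0 1 y]>%VS \in B -> <[vec 1 y 0]>%VS \in B.
Proof.
move=> yB; apply/project_diag/(@project_y 1).
apply: (project (k := y) (i := 1) (j := 1) (project_x p3B) p2B p0B yB).
- det_unit (1 : K).
- vec_ring.
- vec_ring.
Qed.

Definition frame_coords : {set K} := [set x | <[vec 1 x 0]>%VS \in B].

(** Carrying [y] to the vertical through [(1, 0)] gives a line of slope [y] through the origin,
    which has height [x * y] above [(x, 0)]. *)
Lemma frame_coordsM x y : x \in frame_coords -> y \in frame_coords ->
  x * y \in frame_coords.
Proof.
rewrite !inE => xB yB; apply/project_diag/(@project_y x)/project_slope => //.
exact/project_one/project_diagV.
Qed.

Lemma frame_coords0 : 0 \in frame_coords. Proof. by rewrite inE. Qed.

(** The line joining the first two frame points carries [q + 1] points of [B]: the point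
    [<[vec 0 1 0]>] and one [<[vec 1 x 0]>] for each coordinate [x]. *)
Lemma card_frame_coords : #|frame_coords| = q.
Proof.
have [|_ p1n] := @notin_det 1 0 0 0 1 0 0 0 1; first by det_unit (1 : K).
have lM := subplane_join p0B p1B p1n.
case: hB => _ _ pp; have := pp_order pp lM; rewrite -[in RHS]add1n.
have -> : [set P in B | (P <= <[vec 1 0 0]> + <[vec 0 1 0]>)%VS] =
    <[vec 0 1 0]>%VS |: [set <[vec 1 x 0]>%VS | x in frame_coords].
  apply/setP => P; rewrite !inE; apply/andP/orP => [[PB]|[/eqP->|]].
  - have /ppointP[p _ PE] := subplane_point PB; rewrite {}PE in PB *.
    rewrite -memvE => /mem_vline2P[a [b pE]].
    have {}pE : p = vec a b 0 by rewrite pE !comb3Z comb3D; congr comb3; ring.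
    have [a0|a0] := eqVneq a 0; [left|right].
      apply/eqP/eq_vline; first exact: subplane_point_neq0.
      by rewrite pE; apply/vlineP; exists b; rewrite comb3Z a0; congr comb3; ring.
    have eP : <[p]>%VS = <[vec 1 (b / a) 0]>%VS.
      rewrite pE -(scale_vline (vec 1 (b / a) 0) a0) comb3Z.
      by congr (<[comb3 _ _ _ _ _ _]>)%VS; field.
    by apply/imsetP; exists (b / a); rewrite // inE -eP.
  - by split=> //; exact: addvSr.
  case/imsetP => x; rewrite inE => xB ->; split=> //.
  rewrite -memvE; apply/mem_vline2P; exists 1, x; vec_ring.
have vI : {in frame_coords &, injective (fun x => <[vec 1 x 0]>%VS)}.
  move=> x y _ _ /= e; have := memv_line (vec 1 x 0); rewrite e => /vlineP[k].
  by rewrite comb3Z => /(comb3_inj p_free)[]; rewrite mulr1 => <- -> _; rewrite mul1r.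
rewrite cardsU1 (card_in_imset vI).
have -> : <[vec 0 1 0]>%VS \notin [set <[vec 1 x 0]>%VS | x in frame_coords].
  apply/imsetP => -[x _ e]; have := memv_line (vec 0 1 0); rewrite e.
  case/vlineP => k; rewrite comb3Z => /(comb3_inj p_free)[].
  by rewrite mulr1 => <- /eqP; rewrite mul0r oner_eq0.
by rewrite !add1n => -[].
Qed.

Variables (F : finFieldType) (s : {rmorphism F -> K}).
Hypothesis hq : #|F| = q.

(* Multiplicative closure is enough: the q - 1 nonzero coordinates satisfy
   x ^ (q - 1) = 1, which already characterises the subfield of order q. *)
Lemma frame_coords_im x : x \in frame_coords -> exists c, x = s c.
Proof.
move=> xR; apply: expr_card_im; have [->|x0] := eqVneq x 0.
  by rewrite expr0n eqn0Ngt (ltnW (finNzRing_gt1 F)).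
have := cardsD1 0 frame_coords; rewrite frame_coords0 card_frame_coords -hq => ->.
rewrite exprS expr_card_closed ?mulr1 //; first by rewrite !inE eqxx.
move=> y; rewrite in_setD1 => /andP[y0 yR].
by rewrite in_setD1 mulf_neq0 // frame_coordsM.
Qed.

(** Scale the first nonzero coordinate to 1; projections carry each remaining coordinate to the
    first axis, where [frame_coords_im] applies. *)
Lemma frame_rational P : P \in B -> exists a b c, P = <[vec (s a) (s b) (s c)]>%VS.
Proof.
move=> PB; have /ppointP[p _ PE] := subplane_point PB; rewrite {}PE in PB *.
have [a [b [c pE]]] := p_span p.
have [a0|a0] := eqVneq a 0; last first.
  have e : <[p]>%VS = <[vec 1 (b / a) (c / a)]>%VS.
    rewrite pE -(scale_vline (vec 1 (b / a) (c / a)) a0) comb3Z.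
    by congr (<[comb3 _ _ _ _ _ _]>)%VS; field.
  rewrite e in PB *.
  have [|b' ->] := @frame_coords_im (b / a); first by rewrite inE (project_x PB).
  have [|c' ->] := @frame_coords_im (c / a).
    by rewrite inE; apply/project_diag/(project_y PB).
  by exists 1, b', c'; rewrite rmorph1.
have [b0|b0] := eqVneq b 0; last first.
  have e : <[p]>%VS = <[vec 0 1 (c / b)]>%VS.
    rewrite pE -(scale_vline (vec 0 1 (c / b)) b0) comb3Z a0.
    by congr (<[comb3 _ _ _ _ _ _]>)%VS; field.
  rewrite e in PB *.
  have [|c' ->] := @frame_coords_im (c / b); first by rewrite inE project_infty.
  by exists 0, 1, c'; rewrite rmorph1 rmorph0.
exists 0, 0, 1; rewrite rmorph1 rmorph0.
apply: eq_vline; first exact: subplane_point_neq0.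
by rewrite pE; apply/vlineP; exists c; rewrite comb3Z a0 b0; congr comb3; ring.
Qed.

End Frame.

End Subplane.

(** * Tangent splashes *)

Section Club.

Variables (F K : finFieldType) (s : {rmorphism F -> K}).
Variables (B M : {set {vspace 'rV[K]_3}}).
Hypothesis hB : subplane #|F| B M.

Definition rational_frame (p0 p1 p2 : 'rV[K]_3) : Prop :=
  forall P, P \in B ->
    exists a b c, P = <[comb3 p0 p1 p2 (s a) (s b) (s c)]>%VS.

Lemma rational_frame_exists : exists p0 p1 p2, rational_frame p0 p1 p2.
Proof.
have [p0 [p1 [p2 [fr sp [B0 B1 B2 B3]]]]] := subplane_frame hB.
exists p0, p1, p2 => P PB.
by apply: (frame_rational hB fr sp _ _ _ B3 s erefl PB);
  rewrite ?comb3_100 ?comb3_010 ?comb3_001.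
Qed.

Lemma comb3_swap01 (p0 p1 p2 : 'rV[K]_3) a b c :
  comb3 p0 p1 p2 a b c = comb3 p1 p0 p2 b a c.
Proof. by rewrite /comb3 [a *: _ + _]addrC. Qed.

Lemma comb3_swap02 (p0 p1 p2 : 'rV[K]_3) a b c :
  comb3 p0 p1 p2 a b c = comb3 p2 p1 p0 c b a.
Proof. by rewrite /comb3 [LHS]addrC [a *: _ + _]addrC addrA. Qed.

(** Steinitz exchange: division by [s a] expresses [p0] through the new vector, [p1] and [p2] with
    coefficients still in the image of [s]. *)
Lemma rational_frame_exchange p0 p1 p2 a b c : a != 0 -> rational_frame p0 p1 p2 ->
  rational_frame (comb3 p0 p1 p2 (s a) (s b) (s c)) p1 p2.
Proof.
move=> a0 rat P /rat[x [y [z ->]]].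
exists (x / a), (y - x / a * b), (z - x / a * c); congr (<[_]>)%VS.
have subst k b' c' : comb3 (comb3 p0 p1 p2 (s a) (s b) (s c)) p1 p2 k b' c' =
    comb3 p0 p1 p2 (k * s a) (k * s b + b') (k * s c + c').
  rewrite {1}/comb3 comb3Z /comb3 !scalerDl !addrA; congr (_ + _).
  by rewrite addrAC.
have sa0 : s a != 0 by rewrite fmorph_eq0.
rewrite subst !rmorphB !rmorphM !fmorphV !divfK //.
by congr comb3; rewrite addrC subrK.
Qed.

(** Some coordinate of [T] is nonzero; a swap brings it to the front, and [T] is exchanged into the
    frame. *)
Lemma rational_frame_at T : T \in B ->
  exists2 t, T = <[t]>%VS & exists n1 n2, rational_frame t n1 n2.
Proof.
move=> TB; have [p0 [p1 [p2 rat]]] := rational_frame_exists.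
have [a [b [c TE]]] := rat T TB.
exists (comb3 p0 p1 p2 (s a) (s b) (s c)) => //.
have [a0|a0] := eqVneq a 0; last first.
  by exists p1, p2; exact: rational_frame_exchange.
have [b0|b0] := eqVneq b 0; last first.
  exists p0, p2; rewrite comb3_swap01; apply: rational_frame_exchange => //.
  by move=> P /rat[x [y [z ->]]]; exists y, x, z; rewrite comb3_swap01.
exists p1, p0; rewrite comb3_swap02; apply: rational_frame_exchange => //.
  apply/eqP => c0; have := subplane_point hB TB.
  by rewrite TE a0 b0 c0 rmorph0 /comb3 !scale0r !addr0 /ppoint /pdim dim_vline eqxx.
by move=> P /rat[x [y [z ->]]]; exists z, y, x; rewrite comb3_swap02.
Qed.

Lemma subplane_line2 l : l \in M -> exists P Q,
  [/\ P \in B, Q \in B, P != Q, (P <= l)%VS & (Q <= l)%VS].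
Proof.
case: hB => _ _ pp /(pp_order pp) c.
have : (1 < #|[set P in B | (P <= l)%VS]|)%N by rewrite c ltnS ltnW ?finNzRing_gt1.
case/card_gt1P => P [Q []]; rewrite !inE => /andP[PB Pl] /andP[QB Ql] PQ.
by exists P, Q.
Qed.

(* In an F-rational basis (t, n1, n2) with T = <t> and linf given by the
   functional (0, al, be), a line of M not through T is spanned by two vectors
   with coordinates in F; eliminating between them gives its point on linf. *)
Lemma tangent_splash_club linf T : pline linf ->
    [set P in B | (P <= linf)%VS] = [set T] ->
  exists (t u : 'rV[K]_3) (al be : K), T = <[t]>%VS /\
    forall X, X \in splash linf M -> X != T ->
      exists y z, X = <[u + (al * s y + be * s z) *: t]>%VS.
Proof.
move=> /eqP dl BT; have : T \in [set P in B | (P <= linf)%VS] by rewrite BT inE.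
rewrite inE => /andP[TB Tl]; have [t TE [n1 [n2 rat]]] := rational_frame_at TB.
have tl : t \in linf by rewrite memvE -TE.
have [o _ ol] : exists2 o, o \in fullv & o \notin linf.
  by apply: exists_notin; rewrite dl dimvf.
have coord v : exists a, v - a *: o \in linf.
  have : v \in (linf + <[o]>)%VS.
    by rewrite (@add_vlineE _ _ _ fullv) ?memvf ?subvf // dimvf dl.
  by case/memv_addP => w wl [_ /vlineP[a ->] ->]; exists a; rewrite addrK.
(* [al] and [be] are the values at [n1] and [n2] of the functional with kernel [linf] and value 1 at
   [o]. *)
have [[al n1l] [be n2l]] := (coord n1, coord n2).
have meml x c d : (comb3 t n1 n2 x c d \in linf) = (c * al + d * be == 0).
  have -> : comb3 t n1 n2 x c d = (c * al + d * be) *: o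
      + (x *: t + (c *: (n1 - al *: o) + d *: (n2 - be *: o))).
    rewrite !scalerBr !scalerA scalerDl [in RHS]addrCA /comb3 -[LHS]addrA.
    by congr (_ + _); rewrite addrACA [_ *: o + _]addrC subrK [_ *: o + _]addrC subrK.
  rewrite rpredDr; last by rewrite rpredD ?rpredZ // (rpredD (rpredZ _ n1l)) ?rpredZ.
  apply/idP/eqP => [|->]; last by rewrite scale0r mem0v.
  by apply: contraTeq => k0; apply: contra ol => ko; rewrite -[o](scalerK k0) rpredZ.
(* The coordinates [(0, - be, al)] satisfy the equation of [linf] given by [meml]. *)
exists t, (comb3 t n1 n2 0 (- be) al), al, be; split=> // X.
rewrite inE => /and3P[/ppointP[w w0 ->]]; rewrite -memvE => wl.
case/exists_inP => l lM; rewrite -memvE => wl' XT.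
have [P [Q [PB QB PQ Pl Ql]]] := subplane_line2 lM.
have atT R : R \in B -> (R <= linf)%VS -> R = T.
  by move=> RB Rl; apply/eqP; rewrite -in_set1 -BT inE RB.
have [x [c [d PE]]] := rat P PB; have [x' [c' [d' QE]]] := rat Q QB.
set n := comb3 t n1 n2 _ _ _ in PE; set n' := comb3 t n1 n2 _ _ _ in QE.
have n0 : n != 0 by apply: (subplane_point_neq0 hB); rewrite -PE.
have n'0 : n' != 0 by apply: (subplane_point_neq0 hB); rewrite -QE.
have nn' : n \notin <[n']>%VS.
  by apply: contraNN PQ => /(eq_vline n0); rewrite PE QE => ->.
have : w \in (<[n]> + <[n']>)%VS.
  by rewrite -(pline_join n'0 nn' (subplane_line hB lM)) ?memvE -?PE -?QE.
case/mem_vline2P => a [b wE].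
pose phi := s c * al + s d * be; pose phi' := s c' * al + s d' * be.
have ab : a * phi + b * phi' = 0.
  move: wl; rewrite wE /n /n' !comb3Z comb3D meml => /eqP <-.
  by rewrite /phi /phi'; ring.
(* If both vanished, [P] and [Q] would lie on [linf] and both equal [T]. *)
have phi0 : (phi != 0) || (phi' != 0).
  rewrite -negb_and; apply: contraNN PQ => /andP[p0 p'0]; apply/eqP.
  have Pinf : (P <= linf)%VS by rewrite PE -memvE meml.
  have Qinf : (Q <= linf)%VS by rewrite QE -memvE meml.
  by rewrite (atT P PB Pinf) (atT Q QB Qinf).
(* By [ab], the pair [(a, b)] is orthogonal to the nonzero pair [(phi, phi')], hence a multiple of
   [(phi', - phi)]. *)
have [k [ak bk]] : exists k, a = k * phi' /\ b = - (k * phi).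
  case/orP: phi0 => p0.
    exists (- b / phi); split; last by field.
    apply: (mulIf p0); rewrite [RHS](_ : _ = - (b * phi')); last by field.
    by apply/eqP; rewrite -addr_eq0 ab.
  exists (a / phi'); split; first by field.
  apply: (mulIf p0); rewrite [RHS](_ : _ = - (a * phi)); last by field.
  by apply/eqP; rewrite -addr_eq0 addrC ab.
(* [D] is the minor of the last two coordinates of [P] and [Q]. Those of [w] are multiples of [s D],
   so [D = 0] would force [X = T]. *)
pose D := c * d' - c' * d.
have wE' : w = comb3 t n1 n2 (k * (al * s (c' * x - c * x') + be * s (d' * x - d * x')))
    (k * (be * s D)) (- (k * (al * s D))).
  rewrite wE /n /n' !comb3Z comb3D ak bk /phi /phi' /D !rmorphB !rmorphM.
  by congr comb3; ring.
have D0 : D != 0.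
  apply: contraNneq XT => D0; rewrite TE; apply/eqP/eq_vline => //; apply/vlineP.
  rewrite wE' D0 rmorph0 !mulr0 oppr0 /comb3 !scale0r !addr0.
  by eexists.
have k0 : k != 0.
  by apply: contraNneq w0 => k0; rewrite wE' k0 !mul0r oppr0 /comb3 !scale0r !addr0.
have sD0 : s D != 0 by rewrite fmorph_eq0.
(* Dividing [w] by [- (k * s D)] turns its last two coordinates into those of [u]; what is left
   along [t] is an [F]-combination of [al] and [be]. *)
exists (- (c' * x - c * x') / D), (- (d' * x - d * x') / D).
have kD0 : - (k * s D) != 0 by rewrite oppr_eq0 mulf_neq0.
rewrite -[RHS](scale_vline _ kD0); congr (<[_]>)%VS.
have -> (g : K) : comb3 t n1 n2 0 (- be) al + g *: t = comb3 t n1 n2 g (- be) al.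
  by rewrite /comb3 scale0r add0r addrC addrA.
rewrite wE' comb3Z !rmorphM !rmorphN !fmorphV.
by congr comb3; field.
Qed.

End Club.

(** * Sublines, 2-reguli and cover planes *)

Section Regulus.

Variables (F K : finFieldType) (n : nat) (wT : vectType F).
Variables (H : {vspace wT}) (linf : {vspace 'rV[K]_n}).
Variables (bp : {vspace 'rV[K]_n} -> {vspace wT}).
Variables (s : {rmorphism F -> K}) (psi : 'rV[K]_n -> wT).
Hypothesis bp_plane : forall x, x \in linf -> x != 0 ->
  pplane (bp <[x]>%VS) /\ (bp <[x]> <= H)%VS.
Hypothesis psi_surj : forall w, w \in H -> exists2 v, v \in linf & psi v = w.
Hypothesis psi_inj : {in linf &, injective psi}.
Hypothesis psiD : {in linf &, {morph psi : v w / v + w}}.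
Hypothesis psiZ : forall c v, v \in linf -> psi (s c *: v) = c *: psi v.
Hypothesis psi_mem : forall x v, x \in linf -> x != 0 -> v \in linf ->
  (psi v \in bp <[x]>%VS) = (v \in <[x]>%VS).

Lemma psi_0 : psi 0 = 0.
Proof. by have := psiZ 0 (mem0v linf); rewrite rmorph0 !scale0r. Qed.

Lemma psi_neq0 v : v \in linf -> v != 0 -> psi v != 0.
Proof.
by move=> vl; apply: contra_neq; rewrite -psi_0; apply: psi_inj; rewrite ?mem0v.
Qed.

Lemma mem_bp x w : x \in linf -> x != 0 -> w \in bp <[x]>%VS ->
  exists k, w = psi (k *: x).
Proof.
move=> xl x0 wx; have [_ /subvP bH] := bp_plane xl x0.
have [v vl vE] := psi_surj (bH w wx); move: wx; rewrite -vE psi_mem //.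
by case/vlineP => k ->; exists k.
Qed.

Lemma bp_disjoint x y w : x \in linf -> x != 0 -> y \in linf -> y \notin <[x]>%VS ->
  w \in bp <[x]>%VS -> w \in bp <[y]>%VS -> w = 0.
Proof.
move=> xl x0 yl yx; have y0 : y != 0 by apply: contraNneq yx => ->; rewrite mem0v.
move=> /(mem_bp xl x0)[k ->] /(mem_bp yl y0)[j].
move/psi_inj => /(_ (rpredZ _ xl) (rpredZ _ yl)) e; rewrite e.
have [->|j0] := eqVneq j 0; first by rewrite scale0r psi_0.
by case/negP: yx; rewrite -[y](scalerK j0) -e !rpredZ ?memv_line.
Qed.

Variables u t : 'rV[K]_n.
Hypotheses (ul : u \in linf) (tl : t \in linf) (t0 : t != 0).
Hypothesis ut : u \notin <[t]>%VS.

(** [option F] models the projective line over [F], with [None] as the point at infinity; the values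
    represent the points of an [F]-subline through [<[t]>]. *)
Definition subline_point (i : option F) : 'rV[K]_n :=
  if i is Some c then u + s c *: t else t.
Local Notation N := subline_point.

Lemma subline_free a b : a *: u + b *: t = 0 -> a = 0 /\ b = 0.
Proof.
have [->|a0 /eqP e] := eqVneq a 0.
  by rewrite scale0r add0r => /eqP; rewrite scaler_eq0 (negPf t0) orbF => /eqP.
case/negP: ut; rewrite -[u](scalerK a0) rpredZ //.
by apply/vlineP; exists (- b); rewrite scaleNr; apply/eqP; rewrite -addr_eq0.
Qed.

Lemma subline_point_mem i : N i \in linf.
Proof. by case: i => //= c; rewrite rpredD ?rpredZ. Qed.

Lemma subline_point_free i j a b : i != j -> a *: N i + b *: N j = 0 ->
  a = 0 /\ b = 0.
Proof.
case: i j => [c|] [d|] //= cd.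
- rewrite !scalerDr !scalerA addrACA -!scalerDl => /subline_free[/eqP].
  rewrite addr_eq0 => /eqP->; rewrite mulNr addrC -mulrBr => /eqP.
  rewrite mulf_eq0 -rmorphB fmorph_eq0 subr_eq0.
  have /negPf-> : d != c by apply: contra_neq cd => ->.
  by rewrite orbF => /eqP->; rewrite oppr0.
- rewrite scalerDr scalerA -addrA -scalerDl => /subline_free[-> ].
  by rewrite mul0r add0r.
rewrite scalerDr scalerA addrCA -scalerDl => /subline_free[-> ].
by rewrite mul0r addr0.
Qed.

Lemma subline_point_neq0 i : N i != 0.
Proof.
have [j ij] : exists j, i != j by case: i => [c|]; [exists None | exists (Some 0)].
apply/eqP => i0; have [|/eqP] := @subline_point_free i j 1 0 ij.
  by rewrite i0 scaler0 scale0r addr0.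
by rewrite oner_eq0.
Qed.

Lemma subline_point_notin i j : i != j -> N i \notin <[N j]>%VS.
Proof.
move=> ij; apply/vlineP => -[k e].
have [|/eqP] := @subline_point_free i j 1 (- k) ij.
  by rewrite e scale1r scaleNr subrr.
by rewrite oner_eq0.
Qed.

(** For finite parameters the coefficients are the Lagrange weights at [c] and [d], which sum to 1
    and average to [e]; [t] is a scaled difference of two finite points. *)
Lemma subline_point_span i j m : i != j ->
  exists a b, N m = s a *: N i + s b *: N j.
Proof.
case: i j m => [c|] [d|] [e|] //= cd.
- have cd0 : c - d != 0 by rewrite subr_eq0; apply: contra_neq cd => ->.
  exists ((e - d) / (c - d)), ((c - e) / (c - d)).
  rewrite !scalerDr !scalerA addrACA -!scalerDl -!rmorphM -!rmorphD.
  rewrite (_ : _ + _ = 1); last by field.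
  by rewrite rmorph1 scale1r [X in _ = _ + s X *: _](_ : _ = e) //; field.
- have cd0 : c - d != 0 by rewrite subr_eq0; apply: contra_neq cd => ->.
  exists (c - d)^-1, (- (c - d)^-1).
  rewrite !scalerDr !scalerA addrACA -!scalerDl -!rmorphM -!rmorphD subrr.
  rewrite rmorph0 scale0r add0r (_ : _ + _ = 1); last by field.
  by rewrite rmorph1 scale1r.
- exists 1, (e - c); rewrite rmorph1 scale1r -addrA -scalerDl -rmorphD.
  by rewrite [c + _]addrC subrK.
- by exists 0, 1; rewrite rmorph0 rmorph1 scale0r add0r scale1r.
- exists (e - d), 1; rewrite rmorph1 scale1r addrCA -scalerDl -rmorphD.
  by rewrite subrK.
by exists 1, 0; rewrite rmorph0 rmorph1 scale0r addr0 scale1r.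
Qed.

Definition subline_planes : {set {vspace wT}} := [set bp <[N i]>%VS | i : option F].

Lemma subline_planesP A : A \in subline_planes -> exists i, A = bp <[N i]>%VS.
Proof. by case/imsetP => i _ ->; exists i. Qed.

Lemma subline_disjoint i j w : i != j ->
  w \in bp <[N i]>%VS -> w \in bp <[N j]>%VS -> w = 0.
Proof.
move=> ij; apply: bp_disjoint; rewrite ?subline_point_mem ?subline_point_neq0 //.
by rewrite subline_point_notin // eq_sym.
Qed.

Lemma mem_subline_plane i k : psi (k *: N i) \in bp <[N i]>%VS.
Proof.
by rewrite psi_mem ?rpredZ ?memv_line ?subline_point_mem ?subline_point_neq0.
Qed.

(* If a line meets three of the planes in psi (x N i), psi (y N j), psi (z N k),
   writing N k over F in N i, N j shows that x, y are F-multiples of z, so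
   the line is psi of z times the F-span of the subline. *)
Lemma regulus_subline : regulus2 H subline_planes.
Proof.
have Nl := subline_point_mem; have N0 := subline_point_neq0.
split.
- rewrite card_imset ?card_option // => i j e; apply/eqP/negPn/negP => ij.
  have := mem_subline_plane i 1; rewrite scale1r => pi.
  have := subline_disjoint ij pi; rewrite -e => /(_ pi) /eqP.
  by rewrite (negPf (psi_neq0 (Nl i) (N0 i))).
- by move=> A /subline_planesP[i ->]; apply: bp_plane.
- move=> A B /subline_planesP[i ->] /subline_planesP[j ->] AB.
  have ij : i != j by apply: contra_neq AB => ->.
  by apply/meetsP => -[w [w0 wi wj]]; rewrite (subline_disjoint ij wi wj) eqxx in w0.
move=> l A B C /eqP dl lH /subline_planesP[i ->] /subline_planesP[j ->].
case/subline_planesP => k -> AB AC BC.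
have ij : i != j by apply: contra_neq AB => ->.
have ik : i != k by apply: contra_neq AC => ->.
have jk : j != k by apply: contra_neq BC => ->.
move=> /meetsP[vi [vi0 vil vii]] /meetsP[vj [vj0 vjl vjj]] /meetsP[vk [vk0 vkl vkk]].
move=> D /subline_planesP[m ->].
have vij : vi \notin <[vj]>%VS.
  apply: contra vi0 => /vlineP[c e]; apply/eqP/(subline_disjoint ij) => //.
  by rewrite e rpredZ.
have lE := pline_join vj0 vij (introT eqP dl) vil vjl.
move: vkl; rewrite lE => /mem_vline2P[la [mu vkE]].
have [x viE] := mem_bp (Nl i) (N0 i) vii; have [y vjE] := mem_bp (Nl j) (N0 j) vjj.
have [z vkE'] := mem_bp (Nl k) (N0 k) vkk.
have z0 : z != 0 by apply: contraNneq vk0 => z0; rewrite vkE' z0 scale0r psi_0.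
have [a [b Nk]] := subline_point_span k ij.
have [a' [b' Nm]] := subline_point_span m ij.
(* If [a] or [b] vanished, [N k] would represent the same point as [N j] or [N i]. *)
have a0 : a != 0.
  apply: contraNneq (subline_point_notin (i := k) (j := j) _) => [a0|]; last first.
    by rewrite eq_sym.
  by rewrite Nk a0 rmorph0 scale0r add0r rpredZ ?memv_line.
have b0 : b != 0.
  apply: contraNneq (subline_point_notin (i := k) (j := i) _) => [b0|]; last first.
    by rewrite eq_sym.
  by rewrite Nk b0 rmorph0 scale0r addr0 rpredZ ?memv_line.
have : z *: N k = (s la * x) *: N i + (s mu * y) *: N j.
  apply: psi_inj; rewrite ?rpredD ?rpredZ //.
  rewrite psiD ?rpredZ // -!scalerA !psiZ ?rpredZ //.
  by rewrite -viE -vjE -vkE' vkE.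
rewrite Nk scalerDr !scalerA => /eqP; rewrite -subr_eq0 opprD addrACA.
rewrite -!scalerBl => /eqP /(subline_point_free ij)[/subr0_eq xE /subr0_eq yE].
(* As [z * s a = s la * x] and [z * s b = s mu * y], the coordinates of [z *: N m] along [N i] and
   [N j] are [F]-multiples of [x] and [y], so its image lies on the line [l]. *)
apply/meetsP; exists (psi (z *: N m)); split.
- by apply: psi_neq0; rewrite ?rpredZ // scaler_eq0 negb_or z0 N0.
- apply/mem_vline2P; exists (a' / a * la), (b' / b * mu).
  rewrite viE vjE -!psiZ ?rpredZ // -psiD ?rpredZ //; congr psi.
  rewrite Nm scalerDr !scalerA !(rmorphM s) -(mulrA _ (s la)) -(mulrA _ (s mu)).
  rewrite -xE -yE !fmorphV.
  have [sa sb] : s a != 0 /\ s b != 0 by rewrite !fmorph_eq0.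
  by congr (_ *: _ + _ *: _); field.
exact: mem_subline_plane.
Qed.

End Regulus.

(** * Planes meeting the plane of the centre in a line *)

Lemma tangent_splash_cover_plane (F K : finFieldType)
  (H : {vspace 'rV[F]_7}) (S : {set {vspace 'rV[F]_7}})
  (linf : {vspace 'rV[K]_3})
  (bp bl : {vspace 'rV[K]_3} -> {vspace 'rV[F]_7})
  (T : {vspace 'rV[K]_3}) (ST : {set {vspace 'rV[K]_3}})
  (U V W : {vspace 'rV[K]_3}) (pi : {vspace 'rV[F]_7}) :
  bruck_bose H S linf bp bl -> tangent_splash #|F| linf T ST ->
  U \in ST -> V \in ST -> W \in ST -> uniq [:: T; U; V; W] ->
  ~ (exists R : {set {vspace 'rV[F]_7}},
      regulus2 H R /\ [/\ bp T \in R, bp U \in R, bp V \in R & bp W \in R]) ->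
  pplane pi -> (pi <= H)%VS -> pline (pi :&: bp T)%VS ->
  meets pi (bp U) -> meets pi (bp V) -> meets pi (bp W) ->
  cover_plane H (bp @: ST) pi.
Proof.
move=> hBB hST hU hV hW hdist hreg hpi hpiH hpiT hpiU hpiV hpiW.
have [s [psi [psiH psiS [psiI psiA] psiZ psiM]]] := bruck_bose_linear hBB.
have bpP x : x \in linf -> x != 0 -> pplane (bp <[x]>%VS) /\ (bp <[x]> <= H)%VS.
  by move=> xl x0; apply: (bp_infinity hBB); rewrite ?ppoint_vline // -memvE.
have psi0 := psi_0 psiZ; have psiN0 := psi_neq0 psiI psiZ.
have memP := mem_bp bpP psiS psiM.
have [B [M [hB BT STE]]] := hST; subst ST.
have linfP := bb_linf hBB.
have [t [u [al [be [TE club]]]]] := tangent_splash_club s hB linfP BT.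
have : T \in [set P in B | (P <= linf)%VS] by rewrite BT inE.
rewrite inE => /andP[TB Tl].
have tl : t \in linf by rewrite memvE -TE.
have t0 : t != 0 by apply: (subplane_point_neq0 hB); rewrite -TE.
move: hdist; rewrite /= !inE !negb_or andbT => /and3P[/and3P[TU TV TW] /andP[UV UW] VW].
pose N d := u + d *: t; pose d y z : K := al * s y + be * s z.
have [y0 [z0 UE]] : exists y z, U = <[N (d y z)]>%VS.
  by apply: club; rewrite // eq_sym.
have [y1 [z1 VE]] : exists y z, V = <[N (d y z)]>%VS.
  by apply: club; rewrite // eq_sym.
have [y2 [z2 WE]] : exists y z, W = <[N (d y z)]>%VS.
  by apply: club; rewrite // eq_sym.
have dB y z y' z' : d y z - d y' z' = d (y - y') (z - z').
  by rewrite /d !rmorphB; ring.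
have [pU Ul] : ppoint U /\ (U <= linf)%VS by move: hU; rewrite inE => /and3P[].
have NU0 : N (d y0 z0) != 0.
  by move: pU; rewrite UE /ppoint /pdim dim_vline; case: (_ != 0).
have NUl : N (d y0 z0) \in linf by rewrite memvE -UE.
have ut : u \notin <[t]>%VS.
  apply: contraNN TU => ut; rewrite UE TE eq_sym; apply/eqP/eq_vline => //.
  by rewrite rpredD // rpredZ ?memv_line.
have ul : u \in linf by rewrite -(addrK (d y0 z0 *: t) u) rpredB // rpredZ.
have Nl e : N e \in linf by rewrite rpredD ?rpredZ.
have Nt e : N e \notin <[t]>%VS.
  by apply: contra ut => Net; rewrite -(addrK (e *: t) u) rpredB ?rpredZ ?memv_line.
have N0 e : N e != 0 by apply: contraNneq (Nt e) => ->; rewrite mem0v.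
have [vU [vU0 vUpi vUU]] := meetsP _ _ hpiU.
have vUN : vU \in bp <[N (d y0 z0)]>%VS by rewrite -UE.
have [k vUE] := memP _ _ (Nl _) (N0 _) vUN.
have k0 : k != 0 by apply: contraNneq vU0 => k0; rewrite vUE k0 scale0r psi0.
(* [pi] is spanned by its line in [bp T] and one vector [vU = psi (k *: N (d y0 z0))] taken from
   [bp U]. *)
have piE : (pi :&: bp T + <[vU]>)%VS = pi.
  apply: add_vlineE => //; first 2 last.
  - by rewrite (eqP hpi) (eqP hpiT).
  - rewrite memv_cap vUpi /= TE; apply: contra vU0 => vUT; apply/eqP.
    exact: (bp_disjoint bpP psiS psiI psiZ psiM tl t0 (Nl _) (Nt _) vUT vUN).
  exact: capvSl.
(* A common vector is [l + c *: vU] with [l] in [bp T]. Its [u]-coordinate shows [c != 0], and its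
   [t]-coordinate identifies [l] as [c] times the stated vector. *)
have diffP e : meets pi (bp <[N e]>%VS) -> psi ((k * (e - d y0 z0)) *: t) \in pi.
  case/meetsP => v [v0 vpi /(memP _ _ (Nl e) (N0 e))[j vE]].
  move: vpi; rewrite -{1}piE => /memv_addP[l lL [_ /vlineP[c ->] vE']].
  move: lL; rewrite memv_cap TE => /andP[lpi /(memP _ _ tl t0)[f lE]].
  have : j *: N e = f *: t + (s c * k) *: N (d y0 z0).
    have [fl kl] : f *: t \in linf /\ k *: N (d y0 z0) \in linf by rewrite !rpredZ.
    have sl : (s c * k) *: N (d y0 z0) \in linf by exact: rpredZ.
    apply: (psiI _ _ (rpredZ _ (Nl e)) (rpredD fl sl)).
    by rewrite psiA // -scalerA psiZ // -vE -lE -vUE.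
  rewrite /N !scalerDr !scalerA [RHS]addrCA => comb.
  have : (j - s c * k) *: u + (j * e - (f + s c * k * d y0 z0)) *: t = 0.
    by rewrite !scalerBl addrACA -opprD comb -scalerDl subrr.
  case/(subline_free t0 ut) => /subr0_eq jE /subr0_eq fE.
  have c0 : c != 0.
    by apply: contraNneq v0 => c0; rewrite vE jE c0 rmorph0 mul0r scale0r psi0.
  have lE' : l = c *: psi ((k * (e - d y0 z0)) *: t).
    rewrite lE -psiZ ?rpredZ // scalerA; congr (psi (_ *: _)).
    by apply: (addIr (s c * k * d y0 z0)); rewrite -fE jE; ring.
  by rewrite -[psi _](scalerK c0) rpredZ // -lE'.
(* Conversely, adding the stated vector to [vU] moves it from [bp U] into [bp <[N e]>]. *)
have meetP e : psi ((k * (e - d y0 z0)) *: t) \in pi -> meets pi (bp <[N e]>%VS).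
  move=> epi; apply/meetsP; exists (psi (k *: N e)); split.
  - by apply: (psiN0 _ (rpredZ _ (Nl e))); rewrite scaler_eq0 negb_or k0 N0.
  - have -> : k *: N e = k *: N (d y0 z0) + (k * (e - d y0 z0)) *: t.
      by rewrite /N !scalerDr -addrA !scalerA -scalerDl; congr (_ + _ *: _); ring.
    by rewrite (psiA _ _ (rpredZ _ (Nl _)) (rpredZ _ tl)) rpredD // -vUE.
  by rewrite (psiM _ _ (Nl e) (N0 e) (rpredZ _ (Nl e))) rpredZ ?memv_line.
split=> // _ /imsetP[X XST ->].
have [->|XT] := eqVneq X T; first by rewrite /meets -dimv_eq0 (eqP hpiT).
have [y [z ->]] := club X XST XT; rewrite -/(d _ _) -/(N _).
have Vpi : meets pi (bp <[N (d y1 z1)]>%VS) by rewrite -VE.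
have Wpi : meets pi (bp <[N (d y2 z2)]>%VS) by rewrite -WE.
apply: meetP; move: (diffP _ Vpi) (diffP _ Wpi); rewrite !dB.
have dV0 : d (y1 - y0) (z1 - z0) != 0.
  by apply: contraNneq UV; rewrite UE VE -dB => /subr0_eq ->.
have dW : d y2 z2 = d y0 z0 + d (y2 - y0) (z2 - z0) by rewrite -dB addrC subrK.
have dV : d y1 z1 = d y0 z0 + d (y1 - y0) (z1 - z0) by rewrite -dB addrC subrK.
(* Only parameters relative to that of [U] matter from here on, and they again have the form
   [d a b]. *)
move: (y1 - y0) (z1 - z0) (y2 - y0) (z2 - z0) (y - y0) (z - z0) dV0 dV dW.
move=> a1 b1 a2 b2 a b dV0 dV dW piV piW.
have [D0|D0] := eqVneq (a1 * b2 - a2 * b1) 0; last first.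
  (* Cramer's rule over [F]: [(a, b)] is a combination of [(a1, b1)] and [(a2, b2)], so the required
     vector is an [F]-combination of two already in [pi]. *)
  pose m1 := (a * b2 - a2 * b) / (a1 * b2 - a2 * b1).
  pose m2 := (a1 * b - a * b1) / (a1 * b2 - a2 * b1).
  have -> : (k * d a b) *: t =
      s m1 *: ((k * d a1 b1) *: t) + s m2 *: ((k * d a2 b2) *: t).
    rewrite !scalerA -scalerDl; congr (_ *: _).
    have [aE bE] : a = m1 * a1 + m2 * a2 /\ b = m1 * b1 + m2 * b2.
      by rewrite /m1 /m2; split; field.
    by rewrite /d [in LHS]aE [in LHS]bE !rmorphD !rmorphM; ring.
  by rewrite psiA ?rpredZ // !psiZ ?rpredZ // rpredD ?rpredZ.
(* A zero determinant makes the relative parameter of [W] an [F]-multiple of that of [V]; [dV0]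
   excludes [a1 = b1 = 0]. *)
have [c dWV] : exists c, d a2 b2 = s c * d a1 b1.
  have [a10|a10] := eqVneq a1 0; last first.
    have b2E : b2 = a2 / a1 * b1.
      by apply: (mulfI a10); rewrite (subr0_eq D0); field.
    exists (a2 / a1); have a2E : a2 = a2 / a1 * a1 by rewrite divfK.
    by rewrite /d [in RHS]mulrDr !(mulrCA (s _)) -!rmorphM -a2E -b2E.
  have b10 : b1 != 0.
    by apply: contraNneq dV0 => b10; rewrite /d a10 b10 rmorph0 !mulr0 addr0.
  have a20 : a2 = 0.
    by apply/eqP; move/eqP: D0; rewrite a10 mul0r sub0r oppr_eq0 mulf_eq0 (negPf b10) orbF.
  exists (b2 / b1); rewrite /d a10 a20 rmorph0 !mulr0 !add0r mulrCA -rmorphM.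
  by rewrite divfK.
(* With [t] rescaled by the relative parameter of [V], the points [T], [U], [V], [W] lie on one
   subline at infinity, 0, 1 and [c], and its planes form a forbidden 2-regulus. *)
case: hreg; pose t' := d a1 b1 *: t.
have t'l : t' \in linf by rewrite rpredZ.
have t'0 : t' != 0 by rewrite scaler_eq0 negb_or dV0.
have Nt' : N (d y0 z0) \notin <[t']>%VS by rewrite /t' scale_vline.
exists (subline_planes bp s (N (d y0 z0)) t'); split.
  exact: (regulus_subline bpP psiS psiI psiA psiZ psiM (Nl _) t'l t'0 Nt').
rewrite TE UE VE WE -[<[t]>%VS](scale_vline t dV0).
have pt c' : N (d y0 z0) + s c' *: t' = N (d y0 z0 + s c' * d a1 b1).
  by rewrite /N /t' scalerA -addrA -scalerDl.
split; apply/imsetP.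
- by exists None.
- by exists (Some 0); rewrite //= rmorph0 scale0r addr0.
- by exists (Some 1); rewrite //= pt rmorph1 mul1r -dV.
by exists (Some c); rewrite //= pt -dWV -dW.
Qed.

Local Close Scope ring_scope.

Theorem theorem9p6 (q : nat) (F K : finFieldType)
  (hF : #|F| = q) (hK : #|K| = q ^ 3)
  (H : {vspace 'rV[F]_7}) (S : {set {vspace 'rV[F]_7}})
  (linf : {vspace 'rV[K]_3})
  (bp bl : {vspace 'rV[K]_3} -> {vspace 'rV[F]_7})
  (hBB : bruck_bose H S linf bp bl)
  (T : {vspace 'rV[K]_3}) (ST : {set {vspace 'rV[K]_3}})
  (hST : tangent_splash q linf T ST)
  (U V W : {vspace 'rV[K]_3})
  (hU : U \in ST) (hV : V \in ST) (hW : W \in ST)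
  (hdist : uniq [:: T; U; V; W])
  (hreg : ~ exists R : {set {vspace 'rV[F]_7}},
      regulus2 H R /\ [/\ bp T \in R, bp U \in R, bp V \in R & bp W \in R])
  (pi : {vspace 'rV[F]_7})
  (hpi : pplane pi) (hpiH : (pi <= H)%VS)
  (hpiT : pline (pi :&: bp T)%VS)
  (hpiU : meets pi (bp U)) (hpiV : meets pi (bp V)) (hpiW : meets pi (bp W)) :
  cover_plane H (bp @: ST) pi.
Proof.
subst q.
exact: (tangent_splash_cover_plane hBB hST hU hV hW hdist hreg hpi hpiH hpiT).
Qed.
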